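(* Let $\mathcal{C}$ be a category with countable coproducts, $I$ an object and $F\colon\mathcal{C}\to\mathcal{C}$ a functor admitting precise factorizations with respect to the class $\mathrm{Mor}$ of all morphisms. For a pointed $F$-coalgebra $(C,c,i_C)$ define $T_k$, $h_k\colon T_k\to C$ and $F$-precise $t_k\colon T_k\to FT_{k+1}$ ($k\in\mathbb{N}$) by $T_0=I$, $h_0=i_C$, and, for each $k$, $c\cdot h_k=Fh_{k+1}\cdot t_k$ is a precise factorization of $c\cdot h_k$ (with $t_k$ $F$-precise). Equip $\coprod_{k\in\mathbb{N}}T_k$ with the coalgebra structure $[F\mathsf{in}_{k+1}]_{k\in\mathbb{N}}\cdot\coprod_kt_k$ and point $\mathsf{in}_0\colon I=T_0\to\coprod_kT_k$. Then $[h_k]_{k\in\mathbb{N}}\colon\coprod_kT_k\to C$ (the coproduct of levels) is a tree unravelling of $(C,c,i_C)$, i.e. a pointed coalgebra morphism whose domain is a tree.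
   Context: A morphism $p\colon P\to FR$ is $F$-precise (w.r.t. all morphisms) if for all $f\colon P\to FC'$, $m\colon R\to D$, $h\colon C'\to D$ with $Fm\cdot p=Fh\cdot f$ there is $d\colon R\to C'$ with $Fd\cdot p=f$ and $h\cdot d=m$. $F$ admits precise factorizations if every $f\colon S\to FY$ can be written $f=Fh\cdot p$ with $h\colon R\to Y$ arbitrary and $p\colon S\to FR$ $F$-precise (a precise factorization). A pointed $F$-coalgebra is $(C,c,i_C)$ with $c\colon C\to FC$, $i_C\colon I\to C$; a pointed coalgebra morphism $h\colon(T,t,i_T)\to(C,c,i_C)$ satisfies $c\cdot h=Fh\cdot t$ and $h\cdot i_T=i_C$; it is a split epimorphism of pointed coalgebras if some pointed coalgebra morphism $s$ has $h\cdot s=\mathrm{id}$. A pointed coalgebra is a tree if every pointed coalgebra morphism into it is a split epimorphism of pointed coalgebras. *)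

(* Defs.v *)
From mathcomp Require Import all_boot.

Set Implicit Arguments.
Unset Strict Implicit.
Unset Printing Implicit Defensive.

Declare Scope cat_scope.
Delimit Scope cat_scope with cat.
Local Open Scope cat_scope.

Reserved Notation "g \co f" (at level 50, left associativity).

Record category := Category {
  obj :> Type;
  hom : obj -> obj -> Type;
  idm : forall A, hom A A;
  compm : forall A B D, hom B D -> hom A B -> hom A D;
  compm1 : forall A B (f : hom A B), compm f (idm A) = f;
  comp1m : forall A B (f : hom A B), compm (idm B) f = f;
  compmA : forall A B D E (h : hom D E) (g : hom B D) (f : hom A B),
    compm h (compm g f) = compm (compm h g) f
}.

Arguments hom {c} A B.
Arguments idm {c} A.
Arguments compm {c A B D} g f.
Notation "g \co f" := (compm g f) : cat_scope.

Record functor (C D : category) := Functor {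
  fobj :> C -> D;
  fmap : forall A B, hom A B -> hom (fobj A) (fobj B);
  fmap1 : forall A, fmap (idm A) = idm (fobj A);
  fmapM : forall A B E (g : hom B E) (f : hom A B),
    fmap (g \co f) = fmap g \co fmap f
}.

Arguments fmap {C D} F {A B} f : rename.

Record coproduct (C : category) (J : Type) (X : J -> C) := Coproduct {
  cop_obj :> C;
  cop_in : forall j, hom (X j) cop_obj;
  copair : forall Y : C, (forall j, hom (X j) Y) -> hom cop_obj Y;
  copair_in : forall (Y : C) (f : forall j, hom (X j) Y) j,
    copair f \co cop_in j = f j;
  copair_uniq : forall (Y : C) (f : forall j, hom (X j) Y) (g : hom cop_obj Y),
    (forall j, g \co cop_in j = f j) -> g = copair f
}.

Arguments cop_in {C J X} c j.
Arguments copair {C J X} c {Y} f.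

(* A choice of a coproduct for every countable (possibly finite or empty)
   family; theorems quantify over this choice. *)
Definition countable_coproducts (C : category) : Type :=
  forall (J : countType) (X : J -> C), coproduct X.

Definition cop_map (C : category) (J : Type) (X Y : J -> C)
    (cX : coproduct X) (cY : coproduct Y) (f : forall j, hom (X j) (Y j)) :
    hom cX cY :=
  copair cX (fun j => cop_in cY j \co f j).

Section Precise.
Variables (C : category) (F : functor C C).

Definition precise (P R : C) (p : hom P (F R)) : Prop :=
  forall (C' D : C) (f : hom P (F C')) (m : hom R D) (h : hom C' D),
    fmap F m \co p = fmap F h \co f ->
    exists d : hom R C', fmap F d \co p = f /\ h \co d = m.

Definition precise_factorization (S R Y : C) (f : hom S (F Y))
    (h : hom R Y) (p : hom S (F R)) : Prop :=
  f = fmap F h \co p /\ precise p.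

Definition admits_precise_factorizations : Prop :=
  forall (S Y : C) (f : hom S (F Y)),
    exists (R : C) (h : hom R Y) (p : hom S (F R)),
      precise_factorization f h p.

End Precise.

Record pointed_coalg (C : category) (I : C) (F : functor C C) := PointedCoalg {
  carrier :> C;
  struct : hom carrier (F carrier);
  point : hom I carrier
}.

Arguments struct {C I F} p.
Arguments point {C I F} p.
Arguments PointedCoalg {C I F carrier} struct point.

Section PointedCoalgebras.
Variables (C : category) (I : C) (F : functor C C).
Implicit Types X Y T : pointed_coalg I F.

Definition pcoalg_mor X Y (h : hom X Y) : Prop :=
  struct Y \co h = fmap F h \co struct X /\ h \co point X = point Y.

Definition pcoalg_split_epi X Y (h : hom X Y) : Prop :=
  exists s : hom Y X, pcoalg_mor s /\ h \co s = idm Y.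

Definition is_tree T : Prop :=
  forall X (h : hom X T), pcoalg_mor h -> pcoalg_split_epi h.

Definition tree_unravelling T X (h : hom T X) : Prop :=
  pcoalg_mor h /\ is_tree T.

End PointedCoalgebras.

Section Levels.
Variables (C : category) (I : C) (F : functor C C) (X : pointed_coalg I F).

(* The families (T_k) and (h_k) are given by their values at successors, so that
   T_0 = I and h_0 = i_C hold by definition. *)
Definition level (T' : nat -> C) (k : nat) : C :=
  if k is k'.+1 then T' k' else I.

Definition level_map (T' : nat -> C) (h' : forall k, hom (T' k) X) (k : nat) :
    hom (level T' k) X :=
  match k return hom (level T' k) X with
  | 0 => point X
  | k'.+1 => h' k'
  end.

Record precise_levels := PreciseLevels {
  plev_succ : nat -> C;
  plev_map_succ : forall k, hom (plev_succ k) X;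
  plev_struct : forall k, hom (level plev_succ k) (F (level plev_succ k.+1));
  plevP : forall k,
    precise_factorization (struct X \co level_map plev_map_succ k)
      (level_map plev_map_succ k.+1) (plev_struct k)
}.

Definition plev (L : precise_levels) : nat -> C := level (plev_succ L).

Definition plev_map (L : precise_levels) : forall k, hom (plev L k) X :=
  level_map (@plev_map_succ L).

Definition plev_coalg (coprod : countable_coproducts C) (L : precise_levels) :
    pointed_coalg I F :=
  let S := coprod nat (plev L) in
  let FS := coprod nat (fun k => F (plev L k.+1)) in
  PointedCoalg
    (copair FS (fun k => fmap F (cop_in S k.+1)) \co cop_map S FS (@plev_struct L))
    (cop_in S 0).

Definition plev_copair (coprod : countable_coproducts C) (L : precise_levels) :
    hom (plev_coalg coprod L) X :=
  copair (coprod nat (plev L)) (plev_map L).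

End Levels.

(* Main.v *)
(** Given a pointed coalgebra morphism [h : Y -> coprod T_k], a section is built
    level by level: starting from the point of [Y], the preciseness of [t_k]
    lifts [in_(k+1)] along [h] to some [d_(k+1) : T_(k+1) -> Y] with
    [F d_(k+1) . t_k = y . d_k], and the copairing of the [d_k] is a pointed
    coalgebra morphism splitting [h]. *)
Require Import Defs.
From mathcomp Require Import all_boot.
From Stdlib Require Import ClassicalEpsilon.

Set Implicit Arguments.
Unset Strict Implicit.
Unset Printing Implicit Defensive.
Local Open Scope cat_scope.

(** Indefinite description turns [Qex] into a step function, which is then iterated by recursion. *)
Lemma dependent_choice_nat (P : nat -> Type)
    (Q : forall k, P k -> P k.+1 -> Prop) (x0 : P 0) :
  (forall k x, exists y, @Q k x y) ->
  exists f : forall k, P k, f 0 = x0 /\ forall k, Q k (f k) (f k.+1).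
Proof.
move=> Qex; pose step k x := constructive_indefinite_description _ (Qex k x).
exists (nat_rect P x0 (fun k x => proj1_sig (step k x))); split=> // k.
exact: proj2_sig (step k _).
Qed.

Lemma copair_ext (C : category) (J : Type) (X : J -> C) (S : coproduct X)
    (Y : C) (f g : hom S Y) :
  (forall j, f \co cop_in S j = g \co cop_in S j) -> f = g.
Proof. by move=> fg; rewrite (copair_uniq fg) -(copair_uniq (fun=> erefl)). Qed.

Lemma copair_cop_map_in (C : category) (J : Type) (X Y : J -> C)
    (cX : coproduct X) (cY : coproduct Y) (Z : C)
    (g : forall j, hom (Y j) Z) (f : forall j, hom (X j) (Y j)) j :
  copair cY g \co cop_map cX cY f \co cop_in cX j = g j \co f j.
Proof. by rewrite -compmA copair_in compmA copair_in. Qed.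

Section CoproductOfLevels.
Variables (C : category) (coprod : countable_coproducts C) (I : C).
Variables (F : functor C C) (X : pointed_coalg I F).

Lemma precise_levels_inhabited :
  admits_precise_factorizations F -> inhabited (precise_levels X).
Proof.
(* An object and its map to [X] are chosen together, as the next level depends on both. *)
move=> HF; pose P (_ : nat) := {T : C & hom T X}.
pose Q k (x : P k) (y : P k.+1) := exists p : hom (projT1 x) (F (projT1 y)),
  precise_factorization (struct X \co projT2 x) (projT2 y) p.
have [|f [f0 fQ]] := @dependent_choice_nat P Q (existT _ I (point X)).
  move=> k [T u]; have [R [v [p vp]]] := HF _ _ (struct X \co u).
  by exists (existT _ R v), p.
pose T' k := projT1 (f k.+1); pose h' k : hom (T' k) X := projT2 (f k.+1).
have factor k : exists p : hom (level I T' k) (F (level I T' k.+1)),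
    precise_factorization (struct X \co level_map h' k) (level_map h' k.+1) p.
  (* Level 0 is [I] by definition, but [f 0] is the point only up to the equation [f0]; the
     successor levels agree by conversion. *)
  by case: k => [|k]; [have := fQ 0; rewrite f0 | exact: fQ k.+1].
constructor; apply: (@PreciseLevels _ _ _ _ T' h'
  (fun k => proj1_sig (constructive_indefinite_description _ (factor k)))) => k.
exact: proj2_sig (constructive_indefinite_description _ (factor k)).
Qed.

Variable L : precise_levels X.

(* Injections and copairings retyped with the carrier of [plev_coalg], which is
   only convertible to the object underlying the coproduct. *)
Definition plev_in k : hom (plev L k) (plev_coalg coprod L) :=
  cop_in (@coprod nat (plev L)) k.

Definition plev_desc (Y : C) (d : forall k, hom (plev L k) Y) :
    hom (plev_coalg coprod L) Y :=
  copair (@coprod nat (plev L)) d.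

Lemma plev_desc_in (Y : C) (d : forall k, hom (plev L k) Y) k :
  plev_desc d \co plev_in k = d k.
Proof. exact: copair_in. Qed.

Lemma plev_in_ext (Y : C) (f g : hom (plev_coalg coprod L) Y) :
  (forall k, f \co plev_in k = g \co plev_in k) -> f = g.
Proof. exact: copair_ext. Qed.

Lemma struct_plev_in k :
  struct (plev_coalg coprod L) \co plev_in k
  = fmap F (plev_in k.+1) \co plev_struct L k.
Proof. exact: copair_cop_map_in. Qed.

(** Serves twice: for the section built in the tree property and for the copairing of the $h_k$. *)
Lemma pcoalg_mor_plev_desc (Y : pointed_coalg I F)
    (d : forall k, hom (plev L k) Y) :
  d 0 = point Y ->
  (forall k, struct Y \co d k = fmap F (d k.+1) \co plev_struct L k) ->
  pcoalg_mor (plev_desc d).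
Proof.
move=> d0 dS; split; last by rewrite -d0; exact: (plev_desc_in d 0).
apply: plev_in_ext => k.
rewrite -[LHS]compmA -[RHS]compmA struct_plev_in plev_desc_in dS.
by rewrite [RHS]compmA -fmapM plev_desc_in.
Qed.

Lemma plev_coalg_tree : is_tree (plev_coalg coprod L).
Proof.
move=> Y h [h_struct h_point].
(* The equation is carried along because the next lift needs it as input. *)
pose P k := {d : hom (plev L k) Y | h \co d = plev_in k}.
pose Q k (x : P k) (y : P k.+1) :=
  struct Y \co proj1_sig x = fmap F (proj1_sig y) \co plev_struct L k.
have [|d [d0 dQ]] := @dependent_choice_nat P Q (exist _ (point Y) h_point).
  move=> k [d hd]; have [_ t_precise] := plevP L k.
  have [|e [eE he]] := t_precise _ _ (struct Y \co d) (plev_in k.+1) h.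
    (* With $s$ and $y$ the structures of the coproduct and of [Y]: $F\mathsf{in}_{k+1}\cdot t_k =
       s\cdot\mathsf{in}_k = s\cdot h\cdot d = Fh\cdot y\cdot d$. *)
    by rewrite -struct_plev_in -hd !compmA h_struct.
  by exists (exist _ e he).
exists (plev_desc (fun k => proj1_sig (d k))); split.
  by apply: pcoalg_mor_plev_desc => //; rewrite d0.
apply: plev_in_ext => k.
by rewrite -compmA plev_desc_in comp1m; exact: proj2_sig (d k).
Qed.

Lemma plev_copair_mor : pcoalg_mor (plev_copair coprod L).
Proof. by apply: pcoalg_mor_plev_desc => // k; have [] := plevP L k. Qed.

End CoproductOfLevels.

Theorem theorem5p19 (C : category) (coprod : countable_coproducts C) (I : C)
    (F : functor C C) (HF : admits_precise_factorizations F)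
    (X : pointed_coalg I F) :
  inhabited (precise_levels X) /\
  forall L : precise_levels X,
    tree_unravelling (plev_copair coprod L).
Proof.
split; first exact: precise_levels_inhabited.
by move=> L; split; [exact: plev_copair_mor | exact: plev_coalg_tree].
Qed.
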